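(* Let $\mathbb{T}$ be a time scale, $a,b\in\mathbb{T}$ with $a<b$, $I=[a,b]_{\mathbb{T}}$, and $\Box\in\{\Delta,\nabla\}$. Suppose that $g$ is a strictly increasing real function on $I$, $\Box$-differentiable on $I$, such that $g^{\Box}$ is continuous on $(a,b)_{\mathbb{T}}$, and that $f$ is a real bounded function on $I$. Then $f\in\mathcal{R}_{\Box}(g,I)$ if and only if $fg^{\Box}$ is Riemann $\Box$-integrable on $I$, i.e. $fg^{\Box}\in\mathcal{R}_{\Box}(t,I)$. Moreover, $$\int_a^b f(t)\,\Box g(t)=\int_a^b f(t)\,g^{\Box}(t)\,\Box t .$$
   Context: A time scale $\mathbb{T}$ is a nonempty closed subset of $\mathbb{R}$, with the induced topology. The jump operators are $\sigma(t)=\inf\{s\in\mathbb{T}: s>t\}$ and $\rho(t)=\sup\{s\in\mathbb{T}: s<t\}$ (with $\sigma(\max\mathbb{T})=\max\mathbb{T}$, $\rho(\min\mathbb{T})=\min\mathbb{T}$ when these exist). For $a<b$ in $\mathbb{T}$: $[a,b]_{\mathbb{T}}=[a,b]\cap\mathbb{T}$, $(a,b)_{\mathbb{T}}=(a,b)\cap\mathbb{T}$, $[a,b]_{\Delta}=[a,\rho(b)]_{\mathbb{T}}$, $[a,b]_{\nabla}=[\sigma(a),b]_{\mathbb{T}}$. The symbol $\Box$ stands for $\Delta$ or $\nabla$, the same choice throughout. The delta derivative $g^{\Delta}(t)$ is the number such that for every $\varepsilon>0$ there is a neighbourhood $U$ of $t$ with $|g(\sigma(t))-g(s)-g^{\Delta}(t)(\sigma(t)-s)|\le\varepsilon|\sigma(t)-s|$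 for $s\in U$; the nabla derivative $g^{\nabla}(t)$ is defined in the same way with $\rho$ in place of $\sigma$. On $I$, as usual, the $\Delta$-derivative is not considered at $b$ when $b$ is left-scattered, and the $\nabla$-derivative is not considered at $a$ when $a$ is right-scattered (these points lie outside $[a,b]_{\Box}$). $\mathcal{P}(I)$ is the set of partitions of $I=[a,b]_{\mathbb{T}}$, i.e. finite sets $P=\{t_0,\ldots,t_n\}\subset I$ with $a=t_0<\cdots<t_n=b$. For $f$ bounded and $g$ strictly increasing on $I$ and $P\in\mathcal{P}(I)$ put $\Delta g_j=g(t_j)-g(t_{j-1})$, $I_{\Box j}=[t_{j-1},t_j]_{\Box}$, $m_{\Box j}=\inf_{I_{\Box j}}f$, $M_{\Box j}=\sup_{I_{\Box j}}f$, and $$U_{\Box}(P,f,g)=\sum_{j=1}^n M_{\Box j}\Delta g_j,\qquad L_{\Box}(P,f,g)=\sum_{j=1}^n m_{\Box j}\Delta g_j .$$ The upper and lower Darboux-Stieltjes $\Box$-integrals are $\overline{\int_a^b}f\,\Box g=\inf_{P\in\mathcal{P}(I)}U_{\Box}(P,f,g)$ and $\underline{\int_a^b}f\,\Box g=\sup_{P\in\mathcal{P}(I)}L_{\Box}(P,f,g)$. If they are equal, $f$ is called Riemann-Stieltjes $\Box$-integrable with respect to $g$ on $I$, the common value is denoted $\int_a^b f\,\Box g$, and $\mathcal{R}_{\Box}(g,I)$ is the set of all such $f$. The Riemann $\Box$-integral $\int_a^b h(t)\,\Box t$ is the particular case $g(t)=t$, and $\mathcal{R}_{\Box}(t,I)$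 is the corresponding set of integrable functions.
   Formalization: The formal theorem additionally assumes that f·g^□ is bounded on [a,b]_□; without this the claim fails (f = 1 and g differentiable on [0,1] with g′ continuous on (0,1) but unbounded near 0). *)

(* Defs.v *)
From HB Require Import structures.
From mathcomp Require Import all_boot all_order all_algebra.
From mathcomp Require Import all_classical all_reals all_analysis.

Set Implicit Arguments.
Unset Strict Implicit.
Unset Printing Implicit Defensive.

Import Order.TTheory GRing.Theory Num.Theory.
Import numFieldNormedType.Exports.

Local Open Scope classical_set_scope.
Local Open Scope ring_scope.

Inductive box := Delta | Nabla.

Section TimeScale.
Context {R : realType}.
Implicit Types (T S A : set R) (B : box) (f g h : R -> R) (P : seq R).

Definition time_scale T := T !=set0 /\ closed T.

(* The "else" branches are the conventions sigma(max T) = max T and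
   rho(min T) = min T. *)
Definition fwd_jump T (t : R) : R :=
  let later := T `&` [set s | t < s] in
  if `[< later !=set0 >] then inf later else t.

Definition bwd_jump T (t : R) : R :=
  let earlier := T `&` [set s | s < t] in
  if `[< earlier !=set0 >] then sup earlier else t.

Definition box_jump B T : R -> R :=
  match B with Delta => fwd_jump T | Nabla => bwd_jump T end.

(* [a, b]_T *)
Definition ts_cc T (a b : R) : set R := T `&` `[a, b]%classic.

(* (a, b)_T *)
Definition ts_oo T (a b : R) : set R := T `&` `]a, b[%classic.

(* [a, b]_Delta = [a, rho b]_T and [a, b]_Nabla = [sigma a, b]_T *)
Definition box_itv B T (a b : R) : set R :=
  match B with
  | Delta => ts_cc T a (bwd_jump T b)
  | Nabla => ts_cc T (fwd_jump T a) b
  end.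

Definition is_box_derive B S g (t d : R) : Prop :=
  forall e : R, 0 < e -> \forall s \near t, S s ->
    `|g (box_jump B S t) - g s - d * (box_jump B S t - s)|
      <= e * `|box_jump B S t - s|.

(* The box-derivative of g on the time scale S. At an isolated point fixed by
   the jump operator (a left-scattered maximum for Delta, a right-scattered
   minimum for Nabla) every d satisfies is_box_derive, and the value below is
   meaningless; it is never used at such points. *)
Definition box_derive B S g (t : R) : R :=
  xget 0 [set d | is_box_derive B S g t d].

(* A function g on I = [a, b]_T is differentiated with respect to the time
   scale I: the jump operator of T may leave I at an endpoint, where g has no
   value. As long as the jump in T stays in I, the two jumps coincide. *)
Definition box_differentiable B T (a b : R) g : Prop :=
  forall t, box_itv B T a b t -> exists d, is_box_derive B (ts_cc T a b) g t d.

(* As in itv_partition, P lists the points after a: a partition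
   a = t_0 < ... < t_n = b is represented by [:: t_1; ...; t_n]. *)
Definition ts_partition T (a b : R) : set (seq R) :=
  [set P | itv_partition a b P /\ {subset P <= T}].

Definition upper_sum B T (a b : R) f g P : R :=
  let t := nth b (a :: P) in
  \sum_(0 <= j < size P)
    sup (f @` box_itv B T (t j) (t j.+1)) * (g (t j.+1) - g (t j)).

Definition lower_sum B T (a b : R) f g P : R :=
  let t := nth b (a :: P) in
  \sum_(0 <= j < size P)
    inf (f @` box_itv B T (t j) (t j.+1)) * (g (t j.+1) - g (t j)).

Definition upper_integral B T (a b : R) f g : R :=
  inf (upper_sum B T a b f g @` ts_partition T a b).

Definition lower_integral B T (a b : R) f g : R :=
  sup (lower_sum B T a b f g @` ts_partition T a b).

(* Membership in R_box(g, I). All sums only see the values of f on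
   [a, b]_box, which is I minus at most one endpoint; boundedness is required
   there, so that the definition also applies to functions such as a
   box-derivative, which are only defined on [a, b]_box. *)
Definition RS_integrable B T (a b : R) f g : Prop :=
  [bounded f t | t in box_itv B T a b] /\
  lower_integral B T a b f g = upper_integral B T a b f g.

(* The common value of the two integrals, when f is integrable. *)
Definition RS_integral B T (a b : R) f g : R := upper_integral B T a b f g.

Definition R_integrable B T (a b : R) h : Prop := RS_integrable B T a b h id.

Definition R_integral B T (a b : R) h : R := RS_integral B T a b h id.

End TimeScale.

(* Main.v *)
Require Import Defs.
From HB Require Import structures.
From mathcomp Require Import all_boot all_order all_algebra.
From mathcomp Require Import all_classical all_reals all_analysis.
From mathcomp Require Import ring lra.

Import Order.TTheory GRing.Theory Num.Theory.
Import numFieldNormedType.Exports.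

Local Open Scope classical_set_scope.
Local Open Scope ring_scope.

(** The upper integral of f with respect to g is equal to the upper integral of
    f g^box with respect to t, for every bounded f with f g^box bounded, whether
    or not f is integrable. Applied to f and to - f, this makes the upper and
    the lower integrals agree separately, and the theorem follows at once.

    Let F(x, y) and H(x, y) be the two upper integrals over [x, y]_T. Both are
    additive in the interval, so phi(t) = F(a, t) - H(a, t) has increments
    phi(y) - phi(x) = F(x, y) - H(x, y), and the claim is that phi is constant
    on [a, b]_T. Three facts suffice, by a mean value inequality on time scales:
    - phi is continuous on [a, b]_T, endpoints included, because
      |F(x, y)| <= K (g(y) - g(x)) and |H(x, y)| <= K' (y - x), and g is
      continuous where it is box-differentiable;
    - phi does not change across a gap of T, where both integrals reduce to the
      same single term, by the formula for g^box at a scattered point;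
    - phi has derivative 0 at every point of (a, b)_T that is dense on both
      sides. Near such a point t, g^box stays within e of g^box(t), hence so
      does every difference quotient of g, and the Darboux sums of f with
      respect to g and of f g^box differ by at most 2 K e times the length.

    Since g^box is only looked at near interior points, its possible
    unboundedness at a dense endpoint is harmless: there the continuity of phi
    is enough.

    The mean value inequality [mean_value_le] requires the derivative only at
    the points that are dense on both sides, and so does not distinguish Delta
    from Nabla. It also yields the estimate of the difference quotients of g by
    g^box ([box_mean_value_le]) that is used in the third fact. *)

(** * Induction and a mean value inequality on time scales *)
Section Induction.
Context {R : realType}.
Implicit Types (S : set R) (a b t u : R).

Definition left_dense S t := forall u, u < t -> exists2 s, S s & u < s < t.

Definition right_dense S t := forall u, t < u -> exists2 s, S s & t < s < u.

(** The endpoints of a gap: u is the right neighbour of the right-scattered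
    point t, and t the left neighbour of the left-scattered point u. *)
Definition consecutive S t u :=
  [/\ S t, S u, t < u & forall s, S s -> t < s -> u <= s].

Lemma closed_adherent {S x} : closed S ->
  (forall e, 0 < e -> exists2 s, S s & `|s - x| < e) -> S x.
Proof.
move=> cS h; apply: cS => U /nbhs_ballP[e /= e0 eU].
have [s Ss sx] := h e e0.
by exists s; split=> //; apply: eU; rewrite -ball_normE /= distrC.
Qed.

Lemma right_dense_or_next {S t b} : closed S -> S t -> S b -> t < b ->
  right_dense S t \/ exists u, consecutive S t u.
Proof.
move=> cS St Sb tb; pose E := S `&` [set s | t < s].
have E0 : E !=set0 by exists b.
have Elb : has_lbound E by exists t => s [_ /= /ltW].
have infE s : S s -> t < s -> inf E <= s by move=> Ss ts; apply: ge_inf.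
have : t <= inf E by apply: lb_le_inf => // s [_ /= /ltW].
rewrite le_eqVlt => /orP[/eqP tE|tE]; [left|right].
  move=> u tu; have [||s [Ss ts] su] := @inf_adherent _ E (u - t).
  - by rewrite subr_gt0.
  - by split.
  - by exists s => //; rewrite ts /=; move: su; rewrite -tE; lra.
exists (inf E); split=> //; apply: closed_adherent cS _ => e e0.
have [|s [Ss ts] su] := @inf_adherent _ E e e0; first by split.
exists s => //; have := infE s Ss ts.
by rewrite ltr_norml; lra.
Qed.

Lemma left_dense_or_prev {S t a} : closed S -> S t -> S a -> a < t ->
  left_dense S t \/ exists u, consecutive S u t.
Proof.
move=> cS St Sa at_; pose E := S `&` [set s | s < t].
have E0 : E !=set0 by exists a.
have Eub : has_ubound E by exists t => s [_ /= /ltW].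
have supE s : S s -> s < t -> s <= sup E by move=> Ss st; apply: ub_le_sup.
have : sup E <= t by apply: ge_sup => // s [_ /= /ltW].
rewrite le_eqVlt => /orP[/eqP tE|tE]; [left|right].
  move=> u ut; have [||s [Ss ts] su] := @sup_adherent _ E (t - u).
  - by rewrite subr_gt0.
  - by split.
  - by exists s => //; rewrite ts andbT; move: su; rewrite tE; lra.
exists (sup E); split=> //.
  apply: closed_adherent cS _ => e e0.
  have [|s [Ss ts] su] := @sup_adherent _ E e e0; first by split.
  exists s => //; have := supE s Ss ts.
  by rewrite ltr_norml; lra.
by move=> s Ss sEs; rewrite leNgt; apply/negP => st; have := supE s Ss st; lra.
Qed.

(** Real induction: take the largest m such that Q holds on [a, m]. The gap rule
    or the limit rule gives Q m, and the gap rule or the right-neighbourhood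
    rule would go beyond m if m were less than b. *)
Lemma time_scale_induction {S a b} (Q : R -> Prop) :
  closed S -> S a -> S b -> a <= b ->
  Q a ->
  (forall t u, consecutive S t u -> a <= t -> u <= b -> Q t -> Q u) ->
  (forall t, S t -> a < t <= b -> left_dense S t ->
     (forall s, S s -> a <= s < t -> Q s) -> Q t) ->
  (forall t, S t -> a <= t < b -> right_dense S t ->
     (forall s, S s -> a <= s <= t -> Q s) ->
     exists2 d, 0 < d & forall s, S s -> t < s <= b -> s < t + d -> Q s) ->
  Q b.
Proof.
move=> cS Sa Sb ab Qa gapQ leftQ rightQ.
pose A := [set x | [/\ S x, a <= x <= b &
  forall t, S t -> a <= t <= x -> Q t]].
have Aa : A a.
  split=> //; first by rewrite lexx.
  by move=> t St /andP[at_ ta]; have <- : a = t by apply/le_anti; rewrite at_.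
have A0 : A !=set0 by exists a.
have Aub : has_ubound A by exists b => x [_ /andP[]].
have supA x : A x -> x <= sup A by move=> Ax; apply: ub_le_sup.
set m := sup A in supA.
have am : a <= m by exact: supA.
have mb : m <= b by apply: ge_sup => // x [_ /andP[]].
have Sm : S m.
  apply: closed_adherent cS _ => e e0.
  have [|s As su] := @sup_adherent _ A e e0; first by split.
  have [Ss _ _] := As; exists s => //; have := supA s As.
  by rewrite -/m in su *; rewrite ltr_norml; lra.
have Qlt t : S t -> a <= t < m -> Q t.
  move=> St /andP[at_ tm].
  have [y [Sy _ Qy] ty] := sup_gt A0 tm.
  by apply: Qy => //; rewrite at_ ltW.
have Qm : Q m.
  have [<- //|am'] : a = m \/ a < m.
    by move: am; rewrite le_eqVlt => /orP[/eqP|]; [left|right].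
  have [ld|[u [Su _ um nu]]] := left_dense_or_prev cS Sm Sa am'.
    by apply: leftQ => //; rewrite am' mb.
  have au : a <= u by rewrite leNgt; apply/negP => /(nu a Sa); lra.
  by apply: (gapQ u m) => //; apply: Qlt => //; rewrite au um.
have Qle t : S t -> a <= t <= m -> Q t.
  move=> St /andP[at_]; rewrite le_eqVlt => /orP[/eqP -> //|tm].
  by apply: Qlt => //; rewrite at_.
have [<- //|mb'] : m = b \/ m < b.
  by move: mb; rewrite le_eqVlt => /orP[/eqP|]; [left|right].
exfalso.
have [rd|[u [_ Su mu nu]]] := right_dense_or_next cS Sm Sb mb'.
  have [|d d0 Qd] := rightQ m Sm _ rd Qle; first by rewrite am mb'.
  have [|s Ss /andP[ms sl]] := rd (Num.min b (m + d)).
    by rewrite lt_min mb' ltrDl.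
  move: sl; rewrite lt_min => /andP[sb sd].
  suff /supA : A s by lra.
  split=> //; first by lra.
  move=> t St /andP[at_ ts]; have [tm|mt] := lerP t m.
    by apply: Qle => //; rewrite at_.
  by apply: Qd => //; lra.
have ub : u <= b by apply: nu.
suff /supA : A u by lra.
split=> //; first by lra.
move=> t St /andP[at_ tu]; have [tm|mt] := lerP t m.
  by apply: Qle => //; rewrite at_.
have -> : t = u by apply/le_anti; rewrite tu nu.
by apply: (gapQ m u) => //; split.
Qed.

(** At a point scattered on one side and dense on the other, continuity is
    enough. If the point is left-dense, reaching it is a limit. If it is
    left-scattered and right-dense, the small error of leaving it is charged to
    the slack e * length that the gap on its left has kept. At a the error is
    charged to an additive constant e. This makes the inequality usable for both
    box-derivatives: the Delta-derivative says nothing about the left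
    difference quotients at a right-scattered point, and the Nabla-derivative
    nothing about the right ones at a left-scattered point. *)
Lemma mean_value_le {S a b} (phi : R -> R) (c : R) :
  closed S -> S a -> S b -> a <= b -> 0 <= c ->
  (forall t, S t -> a <= t <= b -> forall e, 0 < e -> exists2 d, 0 < d &
     forall s, S s -> a <= s <= b -> `|s - t| < d -> `|phi s - phi t| <= e) ->
  (forall t u, consecutive S t u -> a <= t -> u <= b ->
     `|phi u - phi t| <= c * (u - t)) ->
  (forall t, S t -> a < t < b -> left_dense S t -> right_dense S t ->
     exists2 d, 0 < d & forall s, S s -> a <= s <= b -> `|s - t| < d ->
       `|phi s - phi t| <= c * `|s - t|) ->
  `|phi b - phi a| <= c * (b - a).
Proof.
move=> cS Sa Sb ab c0 cont gap diff.
suff key e : 0 < e -> `|phi b - phi a| <= (c + e) * (b - a) + e.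
  apply/ler_addgt0Pr => e e0.
  have ba1 : 0 < b - a + 1 by lra.
  have := key (e / (b - a + 1)) (divr_gt0 e0 ba1).
  have -> : (c + e / (b - a + 1)) * (b - a) + e / (b - a + 1) =
    c * (b - a) + e by field; rewrite gt_eqF.
  by [].
move=> e0; pose Q x := `|phi x - phi a| <= (c + e) * (x - a) + e.
apply: (@time_scale_induction S a b Q) => //.
- by rewrite /Q !subrr normr0 mulr0 add0r ltW.
- move=> t u tu at_ ub; have := gap t u tu at_ ub; have [_ _ tlu _] := tu.
  rewrite /Q !ler_norml => /andP[h1 h2] /andP[h3 h4].
  have h5 : 0 <= e * (u - t) by rewrite mulr_ge0; lra.
  by apply/andP; split; lra.
- move=> t St /andP[at_ tb] ld Qs; rewrite /Q.
  apply/ler_addgt0Pr => e' e'0.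
  have [|d d0 dt] := cont t St _ e' e'0; first by lra.
  have [|s Ss /andP[sl st]] := ld (Num.max a (t - d)).
    by rewrite gt_max at_; lra.
  move: sl; rewrite gt_max => /andP[as_ sd].
  have := dt s Ss; have := Qs s Ss; rewrite /Q => h1 h2.
  have {}h1 := h1 ltac:(lra).
  have {}h2 := h2 ltac:(lra) ltac:(rewrite ltr_norml; lra).
  have : 0 <= (c + e) * (t - s) by rewrite mulr_ge0; lra.
  move: h1 h2; rewrite !ler_norml => /andP[h1 h2] /andP[h3 h4] h5.
  by apply/andP; split; lra.
- move=> t St /andP[at_ tb] rd Qs.
  have [ta|at'] : t = a \/ a < t.
    by move: at_; rewrite le_eqVlt => /orP[/eqP|]; [left|right].
    (* At t = a the error is covered by the additive constant e. *)
    subst t; have [|d d0 dt] := cont a Sa _ e e0; first by lra.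
    exists d => // s Ss /andP[ts sb] sd; rewrite /Q.
    have := dt s Ss ltac:(lra) ltac:(rewrite ltr_norml; lra).
    have : 0 <= (c + e) * (s - a) by rewrite mulr_ge0; lra.
    lra.
  have Qt := Qs t St ltac:(lra); rewrite /Q in Qt.
  have [ld|[u ut]] := left_dense_or_prev cS St Sa at'.
    have [|d d0 dt] := diff t St _ ld rd; first by lra.
    exists d => // s Ss /andP[ts sb] sd; rewrite /Q.
    have := dt s Ss ltac:(lra) ltac:(rewrite ltr_norml; lra).
    rewrite (gtr0_norm (_ : 0 < s - t)); last by lra.
    have : 0 <= e * (s - t) by rewrite mulr_ge0; lra.
    move: Qt; rewrite !ler_norml => /andP[h1 h2] h5 /andP[h3 h4].
    by apply/andP; split; lra.
  (* t ends a gap (u, t): its cost c * (t - u) leaves e * (t - u). *)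
  have [Su _ utl nu] := ut.
  have au : a <= u by rewrite leNgt; apply/negP => /(nu a Sa); lra.
  have Qu := Qs u Su ltac:(lra); rewrite /Q in Qu.
  have gp := gap u t ut au (ltW tb).
  have [||d d0 dt] := cont t St _ (e * (t - u)).
  - by lra.
  - by rewrite mulr_gt0 // subr_gt0.
  exists d => // s Ss /andP[ts sb] sd; rewrite /Q.
  have := dt s Ss ltac:(lra) ltac:(rewrite ltr_norml; lra).
  have : 0 <= (c + e) * (s - t) by rewrite mulr_ge0; lra.
  move: Qu gp; rewrite !ler_norml => /andP[h1 h2] /andP[h3 h4] h5 /andP[h6 h7].
  by apply/andP; split; lra.
Qed.

End Induction.

(** * The intervals [x, y]_Delta and [x, y]_Nabla *)
Section BoxIntervals.
Context {R : realType}.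
Implicit Types (T : set R) (B : box) (x y z t u v : R).

Lemma bwd_jump_ub T y s : T s -> s < y -> s <= bwd_jump T y.
Proof.
move=> Ts sy; rewrite /bwd_jump /=; case: asboolP => [_|]; last first.
  by case; exists s.
by apply: ub_le_sup => //; exists y => r [_ /= /ltW].
Qed.

Lemma bwd_jump_lub T y m s : T s -> s < y ->
  (forall r, T r -> r < y -> r <= m) -> bwd_jump T y <= m.
Proof.
move=> Ts sy ym; rewrite /bwd_jump /=; case: asboolP => [h|]; last first.
  by case; exists s.
by apply: ge_sup => // r [Tr /= ry]; apply: ym.
Qed.

Lemma bwd_jump_le T y : bwd_jump T y <= y.
Proof.
rewrite /bwd_jump /=; case: asboolP => // h.
by apply: ge_sup => // r [Tr /= /ltW].
Qed.

Lemma fwd_jump_lb T x s : T s -> x < s -> fwd_jump T x <= s.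
Proof.
move=> Ts xs; rewrite /fwd_jump /=; case: asboolP => [_|]; last first.
  by case; exists s.
by apply: ge_inf => //; exists x => r [_ /= /ltW].
Qed.

Lemma fwd_jump_glb T x m s : T s -> x < s ->
  (forall r, T r -> x < r -> m <= r) -> m <= fwd_jump T x.
Proof.
move=> Ts xs xm; rewrite /fwd_jump /=; case: asboolP => [h|]; last first.
  by case; exists s.
by apply: lb_le_inf => // r [Tr /= xr]; apply: xm.
Qed.

Lemma fwd_jump_ge T x : x <= fwd_jump T x.
Proof.
rewrite /fwd_jump /=; case: asboolP => // h.
by apply: lb_le_inf => // r [Tr /= /ltW].
Qed.

Lemma box_itv_bounds {B T x y t} : box_itv B T x y t -> T t /\ x <= t <= y.
Proof.
case: B => -[Tt]; rewrite /= in_itv /= => /andP[xt ty]; split=> //.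
  by rewrite xt (le_trans ty) // bwd_jump_le.
by rewrite ty andbT (le_trans _ xt) // fwd_jump_ge.
Qed.

Lemma box_itv_interior {B T x y t} : T t -> x < t < y -> box_itv B T x y t.
Proof.
move=> Tt /andP[xt ty]; case: B; split=> //; rewrite /= in_itv /=.
  by rewrite (ltW xt) bwd_jump_ub.
by rewrite (ltW ty) andbT fwd_jump_lb.
Qed.

Lemma box_itv_nonempty {B T x y} : T x -> T y -> x < y ->
  box_itv B T x y !=set0.
Proof.
move=> Tx Ty xy; case: B; [exists x|exists y]; split=> //; rewrite /= in_itv /=.
  by rewrite lexx bwd_jump_ub.
by rewrite lexx andbT fwd_jump_lb.
Qed.

(** The intervals overlap at most in y, and no point of T is lost: for Delta,
    nothing of T lies strictly between rho(y) and y. *)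
Lemma box_itv_split {B T x y z} : T x -> T y -> T z -> x < y -> y < z ->
  box_itv B T x z = box_itv B T x y `|` box_itv B T y z.
Proof.
move=> Tx Ty Tz xy yz; apply/seteqP; split=> t.
  case: B => -[Tt]; rewrite /= in_itv /= => /andP[xt tz].
    have [yt|ty] := lerP y t; [right|left]; split=> //; rewrite /= in_itv /=.
      by rewrite yt.
    by rewrite xt bwd_jump_ub.
  have [ty|yt] := lerP t y; [left|right]; split=> //; rewrite /= in_itv /=.
    by rewrite xt.
  by rewrite tz andbT fwd_jump_lb.
case: B; (case=> -[Tt]; rewrite /= in_itv /= => /andP[xt tz]); split=> //;
  rewrite /= in_itv /=; apply/andP; split=> //.
- by have := bwd_jump_le T y; have := bwd_jump_ub _ _ _ Ty yz; lra.
- by lra.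
- by lra.
- by have := fwd_jump_ge T y; have := fwd_jump_lb _ _ _ Ty xy; lra.
Qed.

Lemma box_itv_subset {B T x y u v} : T x -> T y -> T u -> T v ->
  x <= u -> u < v -> v <= y -> box_itv B T u v `<=` box_itv B T x y.
Proof.
move=> Tx Ty Tu Tv xu uv vy t tuv.
have {}tuv : box_itv B T x v t.
  move: xu; rewrite le_eqVlt => /orP[/eqP -> //|xu].
  by rewrite (box_itv_split Tx Tu Tv) //; right.
move: vy; rewrite le_eqVlt => /orP[/eqP <- //|vy].
by rewrite (box_itv_split Tx Tv Ty) //; [left|lra].
Qed.

(** For neighbours x < y of T, the only point of [x, y]_box, which is also the
    point whose jump crosses the gap. *)
Definition box_tag B x y : R := match B with Delta => x | Nabla => y end.

Lemma box_itv_consecutive {B T x y} : consecutive T x y ->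
  box_itv B T x y = [set box_tag B x y].
Proof.
move=> [Tx Ty xy nxy]; have nyx r : T r -> r < y -> r <= x.
  by move=> Tr ry; rewrite leNgt; apply/negP => /(nxy r Tr); lra.
apply/seteqP; split=> t /=.
  case: B => -[Tt]; rewrite /= in_itv /= => /andP[xt ty]; apply/le_anti.
    by rewrite xt andbT (le_trans ty) // (bwd_jump_lub _ _ _ _ Tx).
  by rewrite ty /= (le_trans _ xt) // (fwd_jump_glb _ _ _ _ Ty).
by case: B => ->; split=> //; rewrite /= in_itv /= lexx ?andbT /=;
  [apply: bwd_jump_ub|apply: fwd_jump_lb].
Qed.

End BoxIntervals.

(** * Suprema in Darboux sums *)
Section Supremum.
Context {R : realType}.
Implicit Types (A : set R) (f h : R -> R) (K c d e : R).

Lemma sup_image_ge {A f K t} : (forall t, A t -> `|f t| <= K) -> A t ->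
  f t <= sup (f @` A).
Proof.
move=> fK At; apply: ub_le_sup; last by exists t.
by exists K => _ [s As <-]; rewrite (le_trans (ler_norm _)) ?fK.
Qed.

Lemma sup_image_mul_le {A f c e} : A !=set0 -> 0 <= c ->
  (forall t, A t -> f t * c <= e) -> sup (f @` A) * c <= e.
Proof.
move=> [t At] c0 fe.
have [c0'|{}c0] : c = 0 \/ 0 < c.
  by move: c0; rewrite le_eqVlt => /orP[/eqP|]; [left|right].
  by have := fe t At; rewrite c0' !mulr0.
rewrite -ler_pdivlMr //; apply: ge_sup; first by exists (f t), t.
by move=> _ [s As <-]; rewrite ler_pdivlMr // fe.
Qed.

(** A pointwise comparison of f c with h d passes to the suprema because the
    nonnegative weights c and d commute with them. *)
Lemma sup_image_mul_close {A f h Kf Kh c d e} : A !=set0 ->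
  (forall t, A t -> `|f t| <= Kf) -> (forall t, A t -> `|h t| <= Kh) ->
  0 <= c -> 0 <= d -> (forall t, A t -> `|f t * c - h t * d| <= e) ->
  `|sup (f @` A) * c - sup (h @` A) * d| <= e.
Proof.
move=> A0 fK hK c0 d0 fh; rewrite ler_norml; apply/andP; split.
  suff : sup (h @` A) * d <= sup (f @` A) * c + e by lra.
  apply: sup_image_mul_le => // t At.
  have := fh t At; rewrite ler_norml => /andP[h1 h2].
  have := ler_wpM2r c0 (sup_image_ge fK At).
  lra.
suff : sup (f @` A) * c <= sup (h @` A) * d + e by lra.
apply: sup_image_mul_le => // t At.
have := fh t At; rewrite ler_norml => /andP[h1 h2].
have := ler_wpM2r d0 (sup_image_ge hK At).
lra.
Qed.

End Supremum.

(** * Upper sums and upper integrals *)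
Section UpperSums.
Context {R : realType} {B : box} {T : set R}.
Implicit Types (x y z u v K L : R) (f h G H : R -> R) (P : seq R).

Lemma ts_partition_nil x : ts_partition T x x [::].
Proof. by split=> //; split=> //=. Qed.

Lemma ts_partition_cons x y p P :
  ts_partition T x y (p :: P) <-> [/\ T p, x < p & ts_partition T p y P].
Proof.
split=> [[[/= /andP[xp pP] lP] PT]|[Tp xp [[pP lP] PT]]].
  split=> //; first by apply/set_mem/PT; rewrite inE eqxx.
  by split=> // q qP; apply: PT; rewrite inE qP orbT.
split; first by split=> //=; rewrite xp.
by move=> q; rewrite inE => /orP[/eqP ->|/PT//]; apply/mem_set.
Qed.

Lemma ts_partition_le {x y P} : ts_partition T x y P -> x <= y.
Proof. by move=> [/itv_partition_le]. Qed.

Lemma ts_partition_cat {x y z P Q} : ts_partition T x y P ->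
  ts_partition T y z Q -> ts_partition T x z (P ++ Q).
Proof.
move=> [xyP PT] [yzQ QT]; split; first exact: itv_partition_cat xyP yzQ.
by move=> q; rewrite mem_cat => /orP[/PT|/QT].
Qed.

Lemma ts_partition_exists {x y} : T y -> x <= y ->
  exists P, ts_partition T x y P.
Proof.
move=> Ty; rewrite le_eqVlt => /orP[/eqP <-|xy].
  by exists [::]; exact: ts_partition_nil.
by exists [:: y]; apply/ts_partition_cons; split=> //; exact: ts_partition_nil.
Qed.

Lemma upper_sum_nil x y f G : upper_sum B T x y f G [::] = 0.
Proof. by rewrite /upper_sum big_geq. Qed.

Lemma upper_sum_cons x y f G p P : upper_sum B T x y f G (p :: P) =
  sup (f @` box_itv B T x p) * (G p - G x) + upper_sum B T p y f G P.
Proof. by rewrite /upper_sum /= big_nat_recl. Qed.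

Lemma upper_sum_cat x y z f G P Q : last x P = y ->
  upper_sum B T x z f G (P ++ Q) =
  upper_sum B T x y f G P + upper_sum B T y z f G Q.
Proof.
elim: P x => [|p P IH] x /=; first by move=> ->; rewrite upper_sum_nil add0r.
by move=> lP; rewrite !upper_sum_cons IH // addrA.
Qed.

Lemma upper_sum_close x y f G h H L : T x ->
  (forall u v, T u -> T v -> x <= u -> u < v -> v <= y ->
     `|sup (f @` box_itv B T u v) * (G v - G u) -
       sup (h @` box_itv B T u v) * (H v - H u)| <= L * (v - u)) ->
  forall P, ts_partition T x y P ->
  `|upper_sum B T x y f G P - upper_sum B T x y h H P| <= L * (y - x).
Proof.
move=> Tx fh P; elim: P x Tx fh => [|p P IH] x Tx fh.
  by move=> [/itv_partition_nil -> _]; rewrite !upper_sum_nil !subrr normr0 mulr0.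
move=> /ts_partition_cons[Tp xp pyP]; rewrite !upper_sum_cons.
have py := ts_partition_le pyP.
have h1 := fh x p Tx Tp (lexx x) xp py.
have h2 : `|upper_sum B T p y f G P - upper_sum B T p y h H P| <= L * (y - p).
  by apply: IH => // u v Tu Tv pu; apply: fh => //; lra.
move: h1 h2; rewrite !ler_norml => /andP[h1 h2] /andP[h3 h4].
by apply/andP; split; lra.
Qed.

(** Two neighbours of T have a single partition, whose only term is a supremum
    over one point. *)
Lemma upper_integral_consecutive {x y f G} : consecutive T x y ->
  upper_integral B T x y f G = f (box_tag B x y) * (G y - G x).
Proof.
move=> cxy; have [Tx Ty xy nxy] := cxy.
rewrite /upper_integral.
suff -> : upper_sum B T x y f G @` ts_partition T x y =
    [set f (box_tag B x y) * (G y - G x)] by rewrite inf1.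
have sumE : upper_sum B T x y f G [:: y] = f (box_tag B x y) * (G y - G x).
  by rewrite upper_sum_cons upper_sum_nil addr0 (box_itv_consecutive cxy)
    image_set1 sup1.
apply/seteqP; split=> [_ [[|p P] xyP <-]|_ ->] /=.
- by case: xyP => /itv_partition_nil xy'; move: xy; rewrite xy' ltxx.
- move: xyP => /ts_partition_cons[Tp xp pyP].
  have py : p = y.
    by apply/le_anti; rewrite (ts_partition_le pyP) nxy.
  by subst p; case: pyP => /itv_partitionxx -> _.
- exists [:: y] => //; apply/ts_partition_cons; split=> //.
Qed.

(** The integrator is only known on [a, b]_T, so the intervals [x, y] below stay
    within [a, b]. *)
Section Integrator.
Context {a b : R} {G : R -> R}.
Hypothesis monoG : forall s t, ts_cc T a b s -> ts_cc T a b t -> s <= t ->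
  G s <= G t.

Let dG u v : T u -> T v -> a <= u -> u <= v -> v <= b -> 0 <= G v - G u.
Proof.
move=> Tu Tv au uv vb; rewrite subr_ge0; apply: monoG => //; split=> //;
by rewrite /= in_itv /=; lra.
Qed.

Context {f : R -> R} {K : R}.
Hypothesis fK : forall t, box_itv B T a b t -> `|f t| <= K.
Hypotheses (Ta : T a) (Tb : T b).

Let fKi u v : T u -> T v -> a <= u -> u < v -> v <= b ->
  forall t, box_itv B T u v t -> `|f t| <= K.
Proof. by move=> Tu Tv au uv vb t /(box_itv_subset Ta Tb Tu Tv au uv vb)/fK. Qed.

Lemma upper_sum_bound {x y P} : T x -> a <= x -> y <= b ->
  ts_partition T x y P -> `|upper_sum B T x y f G P| <= K * (G y - G x).
Proof.
elim: P x => [|p P IH] x Tx ax yb.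
  by move=> [/itv_partition_nil -> _]; rewrite !upper_sum_nil !subrr normr0 mulr0.
move=> /ts_partition_cons[Tp xp pyP]; rewrite !upper_sum_cons.
have py := ts_partition_le pyP.
have h2 := IH p Tp ltac:(lra) yb pyP.
have G0 := dG x p Tx Tp ax (ltW xp) ltac:(lra).
have fKxp := fKi x p Tx Tp ax xp ltac:(lra).
have [t xpt] := @box_itv_nonempty _ B _ _ _ Tx Tp xp.
have h1 : sup (f @` box_itv B T x p) * (G p - G x) <= K * (G p - G x).
  apply: ler_wpM2r => //; apply: ge_sup; first by exists (f t), t.
  by move=> _ [s ps <-]; rewrite (le_trans (ler_norm _)) ?fKxp.
have h3 : - K * (G p - G x) <= sup (f @` box_itv B T x p) * (G p - G x).
  apply: ler_wpM2r => //; apply: le_trans (sup_image_ge fKxp xpt).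
  by have := fKxp t xpt; rewrite ler_norml => /andP[].
by move: h2; rewrite !ler_norml => /andP[h4 h5]; apply/andP; split; lra.
Qed.

(** Adding the point y to a partition replaces one supremum by two suprema over
    smaller sets; this is the half of additivity that does not follow from
    concatenating partitions. *)
Lemma upper_sum_refine {x y z P} : T x -> T y -> a <= x -> z <= b ->
  x <= y <= z -> ts_partition T x z P -> exists P1 P2,
  [/\ ts_partition T x y P1, ts_partition T y z P2 &
   upper_sum B T x y f G P1 + upper_sum B T y z f G P2 <=
   upper_sum B T x z f G P].
Proof.
move=> + Ty + zb; elim: P x => [|p P IH] x Tx ax /andP[xy yz].
  move=> [/itv_partition_nil xz _]; subst z.
  have xy' : x = y by apply/le_anti; rewrite xy.
  subst y; exists [::], [::]; rewrite !upper_sum_nil addr0.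
  by split=> //; exact: ts_partition_nil.
move: xy; rewrite le_eqVlt => /orP[/eqP <- Pp|xy].
  by exists [::], (p :: P); rewrite upper_sum_nil add0r; split=> //;
     exact: ts_partition_nil.
move=> /ts_partition_cons[Tp xp pzP]; have pz := ts_partition_le pzP.
have [py|yp] := lerP p y.
  have [||P1 [P2 [pP1 pP2 le12]]] := IH p Tp _ _ pzP; rewrite ?py //; first by lra.
  exists (p :: P1), P2; split=> //; first by apply/ts_partition_cons.
  by rewrite !upper_sum_cons -addrA lerD2l.
exists [:: y], (p :: P); split.
- by apply/ts_partition_cons; split=> //; exact: ts_partition_nil.
- by apply/ts_partition_cons.
rewrite !upper_sum_cons upper_sum_nil addr0 addrA lerD2r.
have fKxp := fKi x p Tx Tp ax xp ltac:(lra).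
have le1 u v : T u -> T v -> x <= u -> u < v -> v <= p ->
    sup (f @` box_itv B T u v) * (G v - G u) <=
    sup (f @` box_itv B T x p) * (G v - G u).
  move=> Tu Tv xu uv vp; have G0 := dG u v Tu Tv ltac:(lra) (ltW uv) ltac:(lra).
  apply: sup_image_mul_le => //; first exact: box_itv_nonempty.
  move=> t uvt; apply: ler_wpM2r => //; apply: (sup_image_ge fKxp).
  exact: (box_itv_subset Tx Tp Tu Tv xu uv vp).
have := le1 x y Tx Ty (lexx x) xy (ltW yp).
have := le1 y p Ty Tp (ltW xy) yp (lexx p).
lra.
Qed.

Let has_inf_upper_sums x y : T x -> T y -> a <= x -> x <= y -> y <= b ->
  has_inf (upper_sum B T x y f G @` ts_partition T x y).
Proof.
move=> Tx Ty ax xy yb; split.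
  have [P Pxy] := ts_partition_exists Ty xy.
  by exists (upper_sum B T x y f G P), P.
exists (- (K * (G y - G x))) => _ [P xyP <-].
by have := upper_sum_bound Tx ax yb xyP; rewrite ler_norml => /andP[].
Qed.

Lemma upper_integral_le {x y P} : T x -> T y -> a <= x -> y <= b ->
  ts_partition T x y P -> upper_integral B T x y f G <= upper_sum B T x y f G P.
Proof.
move=> Tx Ty ax yb xyP; have xy := ts_partition_le xyP.
by apply: ge_inf; [case: (has_inf_upper_sums x y)|exists P].
Qed.

Lemma upper_integral_bound {x y} : T x -> T y -> a <= x -> x <= y -> y <= b ->
  `|upper_integral B T x y f G| <= K * (G y - G x).
Proof.
move=> Tx Ty ax xy yb.
have [[u [P xyP _]] _] := has_inf_upper_sums x y Tx Ty ax xy yb.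
rewrite ler_norml; apply/andP; split.
  apply: lb_le_inf; first by exists (upper_sum B T x y f G P), P.
  move=> _ [Q xyQ <-].
  by have := upper_sum_bound Tx ax yb xyQ; rewrite ler_norml => /andP[].
apply: le_trans (upper_integral_le Tx Ty ax yb xyP) _.
exact: le_trans (ler_norm _) (upper_sum_bound Tx ax yb xyP).
Qed.

Lemma upper_integral_split {x y z} : T x -> T y -> T z ->
  a <= x -> x <= y -> y <= z -> z <= b ->
  upper_integral B T x z f G =
  upper_integral B T x y f G + upper_integral B T y z f G.
Proof.
move=> Tx Ty Tz ax xy yz zb.
have ay := le_trans ax xy; have yb := le_trans yz zb; have xz := le_trans xy yz.
apply/le_anti/andP; split.
  have le12 P Q : ts_partition T x y P -> ts_partition T y z Q ->
      upper_integral B T x z f G <=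
      upper_sum B T x y f G P + upper_sum B T y z f G Q.
    move=> xyP yzQ; have [[_ /eqP lP] _] := xyP.
    rewrite -(upper_sum_cat _ _ _ _ _ _ _ lP).
    by apply: upper_integral_le => //; exact: ts_partition_cat xyP yzQ.
  rewrite -lerBlDr; apply: lb_le_inf; first by case: (has_inf_upper_sums x y).
  move=> _ [P xyP <-]; rewrite lerBlDr -lerBlDl.
  apply: lb_le_inf; first by case: (has_inf_upper_sums y z).
  by move=> _ [Q yzQ <-]; rewrite lerBlDl; exact: le12.
apply: lb_le_inf; first by case: (has_inf_upper_sums x z).
move=> _ [P xzP <-].
have xyz : x <= y <= z by rewrite xy.
have [P1 [P2 [xyP1 yzP2 le12]]] := upper_sum_refine Tx Ty ax zb xyz xzP.
apply: le_trans _ le12; apply: lerD; exact: upper_integral_le.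
Qed.

End Integrator.

(** The estimate is linear in the length of the subinterval, so it adds up
    to the same bound for all partitions, and passes to the infimum. *)
Lemma upper_integral_close {a b f G h H Kf Kh L x y} :
  (forall s t, ts_cc T a b s -> ts_cc T a b t -> s <= t -> G s <= G t) ->
  (forall s t, ts_cc T a b s -> ts_cc T a b t -> s <= t -> H s <= H t) ->
  (forall t, box_itv B T a b t -> `|f t| <= Kf) ->
  (forall t, box_itv B T a b t -> `|h t| <= Kh) ->
  T a -> T b -> T x -> T y -> a <= x -> x <= y -> y <= b ->
  (forall u v, T u -> T v -> x <= u -> u < v -> v <= y ->
     forall t, box_itv B T u v t ->
     `|f t * (G v - G u) - h t * (H v - H u)| <= L * (v - u)) ->
  `|upper_integral B T x y f G - upper_integral B T x y h H| <= L * (y - x).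
Proof.
move=> mG mH fK hK Ta Tb Tx Ty ax xy yb fh.
have sumP : forall P, ts_partition T x y P ->
  `|upper_sum B T x y f G P - upper_sum B T x y h H P| <= L * (y - x).
  apply: upper_sum_close => // u v Tu Tv xu uv vy.
  have au := le_trans ax xu; have vb := le_trans vy yb.
  have Iu : ts_cc T a b u by split=> //; rewrite /= in_itv /=; lra.
  have Iv : ts_cc T a b v by split=> //; rewrite /= in_itv /=; lra.
  have sub := @box_itv_subset _ B T _ _ _ _ Ta Tb Tu Tv au uv vb.
  apply: (@sup_image_mul_close _ _ _ _ Kf Kh); last exact: fh.
  - exact: box_itv_nonempty.
  - by move=> t /sub/fK.
  - by move=> t /sub/hK.
  - by rewrite subr_ge0; apply: mG => //; exact: ltW.
  - by rewrite subr_ge0; apply: mH => //; exact: ltW.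
have [P0 xyP0] := ts_partition_exists Ty xy.
rewrite ler_norml; apply/andP; split.
  rewrite lerBrDr; apply: lb_le_inf.
    by exists (upper_sum B T x y f G P0), P0.
  move=> _ [P xyP <-].
  have := upper_integral_le mH hK Ta Tb Tx Ty ax yb xyP.
  by have := sumP P xyP; rewrite ler_norml => /andP[h1 h2]; lra.
rewrite lerBlDr -lerBlDl; apply: lb_le_inf.
  by exists (upper_sum B T x y h H P0), P0.
move=> _ [P xyP <-].
have := upper_integral_le mG fK Ta Tb Tx Ty ax yb xyP.
by have := sumP P xyP; rewrite ler_norml => /andP[h1 h2]; lra.
Qed.

(** Reduces every statement on lower integrals to one on upper integrals. *)
Lemma lower_integralE x y f G :
  lower_integral B T x y f G = - upper_integral B T x y (fun t => - f t) G.
Proof.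
rewrite /lower_integral /upper_integral /inf opprK; congr sup.
rewrite image_comp; apply: eq_imagel => P _ /=.
rewrite /lower_sum /upper_sum /inf -sumrN; apply: eq_bigr => j _.
by rewrite mulNr image_comp.
Qed.

End UpperSums.

(** * Box-derivatives *)
Section BoxDerivative.
Context {R : realType}.
Implicit Types (S T : set R) (B : box) (a b c d e s t u v : R) (g : R -> R).

Lemma near_dist {t} {P : R -> Prop} : (\forall s \near t, P s) ->
  exists2 d, 0 < d & forall s, `|s - t| < d -> P s.
Proof.
move=> /nbhs_ballP[d /= d0 dP]; exists d => // s st.
by apply: dP; rewrite -ball_normE /= distrC.
Qed.

(** The definition at s = t, for all e: at a point moved by its jump the
    derivative is the difference quotient across the gap. *)
Lemma is_box_derive_jump {B S g t d} : S t -> is_box_derive B S g t d ->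
  g (box_jump B S t) - g t = d * (box_jump B S t - t).
Proof.
move=> St gd; set j := box_jump B S t.
apply/eqP; rewrite -subr_eq0 -normr_le0; apply/ler_addgt0Pr => e e0.
have j0 : 0 < `|j - t| + 1 by rewrite ltr_wpDl.
have := nbhs_singleton (gd (e / (`|j - t| + 1)) (divr_gt0 e0 j0)) St.
move=> /le_trans; apply; rewrite add0r -mulrA ger_pMr // mulrC ler_pdivrMr //.
by rewrite mul1r lerDl.
Qed.

(** Replacing g (box_jump B S t) by its exact value turns the definition into a
    first-order expansion at t itself. Its error is measured from the jump of t:
    it gives continuity everywhere, and a derivative where t is its own jump. *)
Lemma is_box_derive_linear {B S g t d e} : S t -> is_box_derive B S g t d ->
  0 < e -> exists2 r, 0 < r & forall s, S s -> `|s - t| < r ->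
    `|g s - g t - d * (s - t)| <= e * `|box_jump B S t - s|.
Proof.
move=> St gd e0; have gj := is_box_derive_jump St gd.
have [r r0 gr] := near_dist (gd e e0); exists r => // s Ss st.
rewrite (_ : g s - g t - d * (s - t) =
  - (g (box_jump B S t) - g s - d * (box_jump B S t - s))).
  by rewrite normrN; apply: gr.
have -> : g (box_jump B S t) = g t + d * (box_jump B S t - t).
  by rewrite -gj; ring.
by ring.
Qed.

Lemma is_box_derive_continuous {B S g t d e} : S t -> is_box_derive B S g t d ->
  0 < e -> exists2 r, 0 < r & forall s, S s -> `|s - t| < r -> `|g s - g t| <= e.
Proof.
move=> St gd e0; set j := box_jump B S t.
have j0 : 0 < `|j - t| + 1 by rewrite ltr_wpDl.
have d0 : 0 < `|d| + 1 by rewrite ltr_wpDl.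
pose e1 := e / 2 / (`|j - t| + 1); pose r1 := e / 2 / (`|d| + 1).
have e10 : 0 < e1 by rewrite !divr_gt0.
have r10 : 0 < r1 by rewrite !divr_gt0.
have [r r0 gr] := is_box_derive_linear St gd e10.
exists (Num.min r (Num.min r1 1)); first by rewrite !lt_min r0 r10 ltr01.
move=> s Ss; rewrite !lt_min => /and3P[sr sr1 s1].
have h1 : e1 * `|j - s| <= e / 2.
  rewrite /e1 -mulrA ger_pMr ?divr_gt0 // mulrC ler_pdivrMr // mul1r.
  have -> : j - s = (j - t) - (s - t) by ring.
  by rewrite (le_trans (ler_normB _ _)) // lerD2l ltW.
have h2 : `|d * (s - t)| <= e / 2.
  rewrite normrM.
  have : (`|d| + 1) * `|s - t| <= e / 2.
    by rewrite mulrC -ler_pdivlMr // ltW.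
  by have := normr_ge0 (s - t); lra.
have -> : g s - g t = (g s - g t - d * (s - t)) + d * (s - t) by ring.
have := gr s Ss sr; have := ler_normD (g s - g t - d * (s - t)) (d * (s - t)).
lra.
Qed.

(** The only point of [a, b]_T that [a, b]_box can miss is a scattered endpoint,
    at which continuity on [a, b]_T is trivial. *)
Lemma isolated_off_box_itv {B T a b t} : T a -> T b -> a < b -> T t ->
  a <= t <= b -> ~ box_itv B T a b t ->
  exists2 r, 0 < r & forall s, T s -> a <= s <= b -> `|s - t| < r -> s = t.
Proof.
move=> Ta Tb ab Tt /andP[at_ tb] nt; case: B nt => nt.
  have rt : bwd_jump T b < t.
    by rewrite ltNge; apply/negP => tr; apply: nt; split=> //;
    rewrite /= in_itv /= at_.
  have {tb} tb : t = b.
    move: tb; rewrite le_eqVlt => /orP[/eqP //|tb].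
    by exfalso; have := bwd_jump_ub _ _ _ Tt tb; lra.
  exists (t - bwd_jump T b); first by lra.
  move=> s Ts /andP[as_ sb]; rewrite ltr_norml => /andP[h1 h2].
  apply/le_anti; rewrite {1}tb sb leNgt; apply/negP => st.
  by have := bwd_jump_ub T b s Ts ltac:(lra); lra.
have rt : t < fwd_jump T a.
  by rewrite ltNge; apply/negP => tr; apply: nt; split=> //;
  rewrite /= in_itv /= tb tr.
have {at_} ta : a = t.
  move: at_; rewrite le_eqVlt => /orP[/eqP //|at_].
  by exfalso; have := fwd_jump_lb _ _ _ Tt at_; lra.
exists (fwd_jump T a - t); first by lra.
move=> s Ts /andP[as_ sb]; rewrite ltr_norml => /andP[h1 h2].
apply/le_anti; rewrite -{2}ta as_ andbT leNgt; apply/negP => st.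
by have := fwd_jump_lb T a s Ts ltac:(lra); lra.
Qed.

Section Interval.
Context {B : box} {T : set R} {a b : R} {g : R -> R}.
Hypotheses (cT : closed T) (Ta : T a) (Tb : T b) (ab : a < b).
Hypothesis dg : box_differentiable B T a b g.
Let I := ts_cc T a b.
Let gbox := box_derive B I g.

Let inI {t} : T t -> a <= t <= b -> I t.
Proof. by move=> Tt atb; split=> //; rewrite /= in_itv. Qed.

Lemma box_derive_spec {t} : box_itv B T a b t -> is_box_derive B I g t (gbox t).
Proof. by move=> /dg; exact: xgetPex. Qed.

Lemma box_differentiable_continuous {t e} : T t -> a <= t <= b -> 0 < e ->
  exists2 r, 0 < r &
    forall s, T s -> a <= s <= b -> `|s - t| < r -> `|g s - g t| <= e.
Proof.
move=> Tt atb e0.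
have [/box_derive_spec gt|nt] := pselect (box_itv B T a b t).
  have [r r0 gr] := is_box_derive_continuous (inI Tt atb) gt e0.
  by exists r => // s Ts asb; apply: gr; exact: inI.
have [r r0 tr] := isolated_off_box_itv Ta Tb ab Tt atb nt.
exists r => // s Ts asb /(tr s Ts asb) ->.
by rewrite subrr normr0 ltW.
Qed.

Lemma box_derive_consecutive {x y} : consecutive T x y -> a <= x -> y <= b ->
  g y - g x = gbox (box_tag B x y) * (y - x).
Proof.
move=> cxy ax yb; have [Tx Ty xy nxy] := cxy.
have Ix : I x by apply: inI => //; lra.
have Iy : I y by apply: inI => //; lra.
have xyB : box_itv B T a b (box_tag B x y).
  apply: (box_itv_subset Ta Tb Tx Ty ax xy yb).
  by rewrite (box_itv_consecutive cxy).
move: (box_derive_spec xyB); rewrite /gbox; case: B => /= gd.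
  have jx : fwd_jump I x = y.
    apply/le_anti; rewrite fwd_jump_lb //=.
    by apply: (fwd_jump_glb _ _ _ _ Iy) => // r [Tr _]; exact: nxy.
  by have := is_box_derive_jump Ix gd; rewrite /= jx.
have jy : bwd_jump I y = x.
  apply/le_anti; rewrite bwd_jump_ub //= andbT.
  apply: (bwd_jump_lub _ _ _ _ Ix) => // r [Tr _] ry.
  by rewrite leNgt; apply/negP => /(nxy r Tr); lra.
have := is_box_derive_jump Iy gd; rewrite /= jy; lra.
Qed.

Lemma box_jump_dense {t} : T t -> a < t < b -> left_dense T t ->
  right_dense T t -> box_jump B I t = t.
Proof.
move=> Tt /andP[at_ tb] ld rd; case: B => /=; apply/le_anti.
  rewrite fwd_jump_ge andbT leNgt; apply/negP => tj.
  have [|s Ts /andP[ts]] := rd (Num.min b (fwd_jump I t)).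
    by rewrite lt_min tb.
  rewrite lt_min => /andP[sb sj].
  have Is : I s by apply: inI => //; lra.
  by have := fwd_jump_lb _ _ _ Is ts; lra.
rewrite bwd_jump_le /= leNgt; apply/negP => tj.
have [|s Ts /andP[+ st]] := ld (Num.max a (bwd_jump I t)).
  by rewrite gt_max at_.
rewrite gt_max => /andP[as_ js].
have Is : I s by apply: inI => //; lra.
by have := bwd_jump_ub _ _ _ Is st; lra.
Qed.

(** The mean value inequality for t |-> g t - c * t. *)
Lemma box_mean_value_le {u v c e} : T u -> T v -> a <= u -> u < v -> v <= b ->
  (forall t, box_itv B T u v t -> `|gbox t - c| <= e) ->
  `|g v - g u - c * (v - u)| <= e * (v - u).
Proof.
move=> Tu Tv au uv vb gc.
have e0 : 0 <= e.
  have [t /gc] := @box_itv_nonempty _ B _ _ _ Tu Tv uv.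
  exact: le_trans.
have sub := @box_itv_subset _ B _ _ _ _ _ Ta Tb Tu Tv au uv vb.
suff key d : 0 < d -> `|g v - g u - c * (v - u)| <= (e + d) * (v - u).
  apply/ler_addgt0Pr => d d0; have vu0 : 0 < v - u by lra.
  have := key (d / (v - u)) (divr_gt0 d0 vu0).
  by rewrite mulrDl divfK ?gt_eqF.
move=> d0; pose phi t := g t - c * t.
have -> : g v - g u - c * (v - u) = phi v - phi u by rewrite /phi; ring.
have cd1 : 0 < `|c| + 1 by rewrite ltr_wpDl.
apply: (mean_value_le phi (e + d) cT Tu Tv (ltW uv)); first by lra.
- move=> t Tt utv h h0; have h20 : 0 < h / 2 by rewrite divr_gt0.
  have [|r r0 gr] := box_differentiable_continuous Tt _ h20; first by lra.
  exists (Num.min r (h / 2 / (`|c| + 1))); first by rewrite lt_min r0 divr_gt0.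
  move=> s Ts usv; rewrite lt_min => /andP[sr sc].
  have -> : phi s - phi t = (g s - g t) - c * (s - t) by rewrite /phi; ring.
  have h1 := gr s Ts ltac:(lra) sr.
  have h2 : `|c * (s - t)| <= h / 2.
    rewrite normrM.
    have : (`|c| + 1) * `|s - t| <= h / 2.
      by rewrite mulrC -ler_pdivlMr // ltW.
    by have := normr_ge0 (s - t); lra.
  by have := ler_normB (g s - g t) (c * (s - t)); lra.
- move=> x y cxy ux yv; have [Tx Ty xy _] := cxy.
  have gxy := box_derive_consecutive cxy ltac:(lra) ltac:(lra).
  have -> : phi y - phi x = (gbox (box_tag B x y) - c) * (y - x).
    by rewrite mulrBl -gxy /phi; ring.
  have yx0 : 0 < y - x by lra.
  rewrite normrM (gtr0_norm yx0) ler_pM2r //.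
  suff : `|gbox (box_tag B x y) - c| <= e by lra.
  apply: gc; apply: (box_itv_subset Tu Tv Tx Ty ux xy yv).
  by rewrite (box_itv_consecutive cxy).
- move=> t Tt utv ld rd; have atb : a < t < b by lra.
  have tB : box_itv B T u v t := box_itv_interior Tt utv.
  have It : I t by apply: inI => //; lra.
  have [r r0 gr] := is_box_derive_linear It (box_derive_spec (sub t tB)) d0.
  exists r => // s Ts usv sr.
  have Is : I s by apply: inI => //; lra.
  have := gr s Is sr; rewrite box_jump_dense // (distrC t s) => h1.
  have -> : phi s - phi t =
    (g s - g t - gbox t * (s - t)) + (gbox t - c) * (s - t).
    by rewrite /phi; ring.
  have h2 : `|(gbox t - c) * (s - t)| <= e * `|s - t|.
    by rewrite normrM ler_wpM2r // gc.
  rewrite (le_trans (ler_normD _ _)) //.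
  by rewrite [leRHS]mulrDl [leRHS]addrC lerD.
Qed.

Hypothesis gincr : forall s t, I s -> I t -> s < t -> g s < g t.
Hypothesis cgbox : {within ts_oo T a b, continuous gbox}.

Lemma box_derive_near {t e} : T t -> a < t < b -> 0 < e ->
  exists2 r, 0 < r & forall s, T s -> `|s - t| < r ->
    a < s < b /\ `|gbox s - gbox t| <= e.
Proof.
move=> Tt /andP[at_ tb] e0.
have Ot : ts_oo T a b t by split=> //; rewrite /= in_itv /= at_.
have /cvgrPdist_le /(_ e e0) :
    gbox x @[x --> within (ts_oo T a b) (nbhs t)] --> gbox t.
  by move/subspace_continuousP : cgbox; apply.
move=> /near_dist[r r0 gr].
exists (Num.min r (Num.min (t - a) (b - t))); first by rewrite !lt_min r0; lra.
move=> s Ts; rewrite !lt_min => /and3P[sr].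
rewrite !ltr_norml => h1 h2; have asb : a < s < b by lra.
by split=> //; rewrite distrC; apply: gr => //; split=> //; rewrite /= in_itv.
Qed.

Let gmono s t : I s -> I t -> s <= t -> g s <= g t.
Proof.
move=> Is It; rewrite le_eqVlt => /orP[/eqP -> //|st].
exact/ltW/gincr.
Qed.

(** The heart of the theorem: the difference phi of the two upper integrals over
    [a, t] satisfies the mean value inequality with every constant L > 0. *)
Lemma upper_integral_box_derive {f : R -> R} {Kf Kh : R} :
  (forall t, box_itv B T a b t -> `|f t| <= Kf) ->
  (forall t, box_itv B T a b t -> `|f t * gbox t| <= Kh) ->
  upper_integral B T a b f g =
  upper_integral B T a b (fun t => f t * gbox t) id.
Proof.
move=> fK hK; pose h t := f t * gbox t.
have [t0 at0b] := @box_itv_nonempty _ B _ _ _ Ta Tb ab.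
have Kf0 : 0 <= Kf by apply: le_trans (fK _ at0b).
have Kh0 : 0 <= Kh by apply: le_trans (hK _ at0b).
have idmono s t : I s -> I t -> s <= t -> (id s : R) <= id t by [].
pose F x y := upper_integral B T x y f g.
pose H x y := upper_integral B T x y h id.
have FE x y : T x -> T y -> a <= x -> x <= y -> y <= b -> F a y - F a x = F x y.
  move=> Tx Ty ax xy yb; rewrite /F.
  by rewrite (upper_integral_split gmono fK Ta Tb Ta Tx Ty) // addrC addKr.
have HE x y : T x -> T y -> a <= x -> x <= y -> y <= b -> H a y - H a x = H x y.
  move=> Tx Ty ax xy yb; rewrite /H.
  by rewrite (upper_integral_split idmono hK Ta Tb Ta Tx Ty) // addrC addKr.
pose phi t := F a t - H a t.
have phiE x y : T x -> T y -> a <= x -> x <= y -> y <= b ->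
    phi y - phi x = F x y - H x y.
  by move=> *; rewrite -FE // -HE // /phi; ring.
have phi_bound x y : T x -> T y -> a <= x -> x <= y -> y <= b ->
    `|phi y - phi x| <= Kf * `|g y - g x| + Kh * `|y - x|.
  move=> Tx Ty ax xy yb; rewrite phiE // (le_trans (ler_normB _ _)) // lerD //.
    apply: le_trans (upper_integral_bound gmono fK Ta Tb Tx Ty ax xy yb) _.
    by rewrite ler_wpM2l // ler_norm.
  apply: le_trans (upper_integral_bound idmono hK Ta Tb Tx Ty ax xy yb) _.
  by rewrite ler_wpM2l // ler_norm.
have phi_bound' x y : T x -> T y -> a <= x <= b -> a <= y <= b ->
    `|phi y - phi x| <= Kf * `|g y - g x| + Kh * `|y - x|.
  move=> Tx Ty axb ayb; have [xy|yx] := orP (le_total x y).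
    by apply: phi_bound => //; lra.
  rewrite (distrC (phi y)) (distrC (g y)) (distrC y).
  by apply: phi_bound => //; lra.
have phia : phi a = 0.
  have axx := lexx a.
  have := upper_integral_bound gmono fK Ta Tb Ta Ta axx axx (ltW ab).
  have := upper_integral_bound idmono hK Ta Tb Ta Ta axx axx (ltW ab).
  rewrite !subrr !mulr0 !normr_le0 => /eqP H0 /eqP F0.
  by rewrite /phi /F /H F0 H0 subr0.
suff key L : 0 < L -> `|phi b - phi a| <= L * (b - a).
  apply/eqP; rewrite -subr_eq0 -normr_le0; apply/ler_addgt0Pr => e e0.
  have ba0 : 0 < b - a by rewrite subr_gt0.
  have := key (e / (b - a)) (divr_gt0 e0 ba0).
  by rewrite phia subr0 divfK ?gt_eqF // add0r.
move=> L0; apply: (mean_value_le phi L cT Ta Tb (ltW ab) (ltW L0)).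
- move=> t Tt atb e e0.
  have Kf1 : 0 < Kf + 1 by lra.
  have Kh1 : 0 < Kh + 1 by lra.
  have e10 : 0 < e / 2 / (Kf + 1) by rewrite !divr_gt0.
  have [r r0 gr] := box_differentiable_continuous Tt atb e10.
  exists (Num.min r (e / 2 / (Kh + 1))); first by rewrite lt_min r0 !divr_gt0.
  move=> s Ts asb; rewrite lt_min => /andP[sr sK].
  apply: le_trans (phi_bound' t s Tt Ts atb asb) _.
  have : `|g s - g t| * (Kf + 1) <= e / 2 by rewrite -ler_pdivlMr // gr.
  have : `|s - t| * (Kh + 1) <= e / 2 by rewrite -ler_pdivlMr // ltW.
  by have := normr_ge0 (s - t); have := normr_ge0 (g s - g t); lra.
- move=> x y cxy ax yb; have [Tx Ty xy _] := cxy.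
  rewrite phiE // ?(ltW xy) // /F /H.
  rewrite !(upper_integral_consecutive cxy).
  rewrite (box_derive_consecutive cxy ax yb) /h mulrA subrr normr0.
  by rewrite mulr_ge0; lra.
- move=> t Tt atb _ _.
  have Kf1 : 0 < 2 * (Kf + 1) by lra.
  pose e := L / (2 * (Kf + 1)).
  have e0 : 0 < e by rewrite divr_gt0.
  have eL : Kf * (2 * e) <= L.
    have : e * (2 * (Kf + 1)) = L by rewrite divfK ?gt_eqF.
    by lra.
  have [r r0 gr] := box_derive_near Tt atb e0.
  (* f (g v - g u) - h (v - u) is f times the sum of two errors, the one of
     the difference quotient and the one of gbox, each at most e * (v - u). *)
  have close x y : T x -> T y -> x <= y -> t - r < x -> y < t + r ->
      `|phi y - phi x| <= L * (y - x).
    move=> Tx Ty xy tx yt.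
    have [/andP[ax xb] _] : a < x < b /\ `|gbox x - gbox t| <= e.
      by apply: gr => //; rewrite ltr_norml; lra.
    have [/andP[ay yb] _] : a < y < b /\ `|gbox y - gbox t| <= e.
      by apply: gr => //; rewrite ltr_norml; lra.
    rewrite phiE // ?(ltW ax) ?(ltW yb) //.
    apply: (upper_integral_close gmono idmono fK hK) => //; try exact: ltW.
    move=> u v Tu Tv xu uv vy q uvq.
    have gq q' : box_itv B T u v q' -> `|gbox q' - gbox t| <= e.
      move=> /box_itv_bounds[Tq' uq'v].
      have [|_ //] := gr q' Tq'.
      by rewrite ltr_norml; lra.
    have mv := box_mean_value_le Tu Tv ltac:(lra) uv ltac:(lra) gq.
    have -> : f q * (g v - g u) - h q * (id v - id u) =
        f q * ((g v - g u - gbox t * (v - u)) - (gbox q - gbox t) * (v - u)).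
      by rewrite /h /=; ring.
    have vu0 : 0 < v - u by lra.
    rewrite normrM; apply: (@le_trans _ _ (Kf * (2 * e * (v - u)))).
      apply: ler_pM => //.
        apply: fK; apply: (box_itv_subset Ta Tb Tu Tv _ uv _ q uvq); lra.
      rewrite (le_trans (ler_normB _ _)) // normrM (gtr0_norm vu0).
      by have := ler_wpM2r (ltW vu0) (gq q uvq); lra.
    by rewrite mulrA ler_wpM2r // ltW.
  exists r => // s Ts asb; rewrite ltr_norml => /andP[h1 h2].
  have [ts|st] := orP (le_total t s).
    by rewrite (ger0_norm (_ : 0 <= s - t)) ?subr_ge0 //; apply: close => //; lra.
  rewrite !(distrC _ t) (distrC _ (phi t)).
  by rewrite (ger0_norm (_ : 0 <= t - s)) ?subr_ge0 //; apply: close => //; lra.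
Qed.

End Interval.
End BoxDerivative.

Lemma bounded_in_ex {R : realType} {A : set R} {f : R -> R} :
  [bounded f t | t in A] -> exists K, forall t, A t -> `|f t| <= K.
Proof.
move=> [M [_ fM]]; exists (M + 1) => t At.
by apply: (fM (M + 1)) => //; rewrite ltrDl.
Qed.

(* The hypothesis that f g^box is bounded is what gives a meaning to its
   Darboux sums: g^box is only assumed continuous on the open interval, so it
   may be unbounded near a dense endpoint. *)
Theorem theorem4p3 (R : realType) (T : set R) (B : box) (a b : R)
    (f g : R -> R)
    (I := ts_cc T a b) (gbox := box_derive B I g) :
  time_scale T -> T a -> T b -> a < b ->
  (forall s t, I s -> I t -> s < t -> g s < g t) ->
  box_differentiable B T a b g ->
  {within ts_oo T a b, continuous gbox} ->
  [bounded f t | t in I] ->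
  [bounded f t * gbox t | t in box_itv B T a b] ->
  (RS_integrable B T a b f g <->
     R_integrable B T a b (fun t => f t * gbox t)) /\
  (RS_integrable B T a b f g ->
     RS_integral B T a b f g = R_integral B T a b (fun t => f t * gbox t)).
Proof.
move=> [_ cT] Ta Tb ab gincr dg cgbox fI hbd.
have boxI : box_itv B T a b `<=` I.
  by move=> t /box_itv_bounds[Tt atb]; split=> //; rewrite /= in_itv.
have [Kf fKI] := bounded_in_ex fI; have [Kh hK] := bounded_in_ex hbd.
have fK t : box_itv B T a b t -> `|f t| <= Kf by move=> /boxI/fKI.
have fbd : [bounded f t | t in box_itv B T a b].
  by case: fI => M [Mr fM]; exists M; split=> // x Mx t /boxI; apply: fM.
have upperE : upper_integral B T a b f g =
    upper_integral B T a b (fun t => f t * gbox t) id.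
  exact: (upper_integral_box_derive cT Ta Tb ab dg gincr cgbox fK hK).
have lowerE : lower_integral B T a b f g =
    lower_integral B T a b (fun t => f t * gbox t) id.
  rewrite !lower_integralE; congr (- _).
  rewrite (_ : (fun t => - (f t * gbox t)) = (fun t => - f t * gbox t)).
    apply: (@upper_integral_box_derive _ B T a b g cT Ta Tb ab dg gincr cgbox _ Kf Kh).
      by move=> t; rewrite normrN; exact: fK.
    by move=> t; rewrite mulNr normrN; exact: hK.
  by apply/funext => t; rewrite mulNr.
rewrite /RS_integral /R_integral /RS_integral /R_integrable /RS_integrable.
by rewrite -lowerE -upperE; split; first split=> -[].
Qed.
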